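(* Let $\{\alpha_n\}_{n=0}^{\infty}$ be a sequence of real numbers for which there is a natural number $N$ with $|\alpha_n|\neq 1$ for $0\le n\le N-1$ and $|\alpha_n|<1$ for $n\ge N$. Let $\mu$ be the linear functional corresponding to $\{\alpha_n\}$, $\{\Phi_n\}$ the corresponding monic polynomials, and $\gamma$ the linear functional on polynomials defined by $\langle g(x),\gamma\rangle_x=\langle g(w+\overline w),\mu\rangle_w$ (all as defined in the context). Then $\gamma$ is quasi-definite, meaning that there exists a sequence of monic polynomials $\{P_n\}_{n=0}^\infty$ with $\deg P_n=n$ such that, for $n=0,1,\dots$, $$\langle x^kP_n(x),\gamma\rangle_x=0,\quad k=0,1,\dots,n-1,\qquad\text{and}\qquad \langle x^nP_n(x),\gamma\rangle_x\neq 0.$$ In addition, the polynomials $P_n$ obey the formula $$P_n\left(z+\frac1z\right)=(1-\alpha_{2n-1})^{-1}z^{-n}\left[\Phi_{2n}(z)+\Phi_{2n}^*(z)\right],$$ where $\alpha_{-1}:=-1$.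
   Context: Polynomials: $\Phi_0(z)=1$, $\Phi_{n+1}(z)=z\Phi_n(z)-\overline{\alpha}_n\Phi_n^*(z)$, where $\Phi_n^*(z)=z^n\overline{\Phi_n(1/\overline z)}$. Functional $\mu$: writing $\Phi_n(z)=z^n+\sum_{j=0}^{n-1}t_j^{(n)}z^j$, $\mu$ is the linear functional on Laurent polynomials with $\mu(1)=1$, $\mu(z^n)=-\sum_{j=0}^{n-1}t_j^{(n)}\mu(z^j)$ and $\mu(z^{-n})=\overline{\mu(z^n)}$ for $n\in\mathbb{N}$. One writes $\langle h(w),\mu\rangle_w=\mu(h)$ and sets $\mu(z^j\overline z^k)=\mu(z^{j-k})$, i.e. $\overline w$ is identified with $w^{-1}$. Functional $\gamma$: for every polynomial $g$, $\langle g(x),\gamma\rangle_x=\langle g(w+\overline w),\mu\rangle_w=\mu\big(g(w+w^{-1})\big)$. *)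

(* Defs.v *)
From HB Require Import structures.
From mathcomp Require Import all_boot all_order all_algebra.
From mathcomp Require Import finmap.
From mathcomp Require Import monalg.

Set Implicit Arguments.
Unset Strict Implicit.
Unset Printing Implicit Defensive.

Import Order.TTheory GRing.Theory Num.Theory.
Local Open Scope fset_scope.
Local Open Scope ring_scope.

(* Laurent polynomials are finitely supported coefficient families indexed by
   int. multinomials only puts a product on {malg C[K]} when K is a monoid
   without nontrivial units, which excludes int, so the Cauchy product is
   defined here. *)
Definition laurent (C : comNzRingType) : Type := {malg C[int]}.

Section LaurentRing.
Variable C : comNzRingType.

HB.instance Definition _ := GRing.Lmodule.on (laurent C).

Implicit Types (f g h : laurent C) (k : int).

Definition zpow k : laurent C := << k >>.

Definition lmul f g : laurent C :=
  \sum_(k1 <- msupp f) \sum_(k2 <- msupp g) (f@_k1 * g@_k2) *: zpow (k1 + k2).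

Lemma lmulw (d1 d2 : {fset int}) f g :
  msupp f `<=` d1 -> msupp g `<=` d2 ->
  lmul f g =
    \sum_(k1 <- d1) \sum_(k2 <- d2) (f@_k1 * g@_k2) *: zpow (k1 + k2).
Proof.
move=> le1 le2; rewrite /lmul (big_fset_incl _ le1) /=.
  apply: eq_bigr => k1 _; apply: big_fset_incl => // k _ /mcoeff_outdom ->.
  by rewrite mulr0 scale0r.
move=> k _ /mcoeff_outdom fk.
by rewrite big1 // => k' _; rewrite fk mul0r scale0r.
Qed.

Lemma lmulC : commutative lmul.
Proof.
move=> f g; rewrite /lmul exchange_big /=.
by apply: eq_bigr => k _; apply: eq_bigr => l _; rewrite mulrC addrC.
Qed.

Lemma lmulDl : left_distributive lmul +%R.
Proof.
move=> f g h.
rewrite (lmulw (msuppD_le _ _) (fsubset_refl _)).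
rewrite [lmul f h](lmulw (fsubsetUl _ (msupp g)) (fsubset_refl _)).
rewrite [lmul g h](lmulw (fsubsetUr (msupp f) _) (fsubset_refl _)).
rewrite -big_split /=; apply: eq_bigr => k _.
rewrite -big_split /=; apply: eq_bigr => l _.
by rewrite mcoeffD mulrDl scalerDl.
Qed.

Lemma lmulDr : right_distributive lmul +%R.
Proof. by move=> f g h; rewrite lmulC lmulDl lmulC [lmul h f]lmulC. Qed.

Lemma lmul0l : left_zero 0 lmul.
Proof. by move=> g; rewrite /lmul msupp0 big_seq_fset0. Qed.

Lemma lmulr0 : right_zero 0 lmul.
Proof. by move=> g; rewrite lmulC lmul0l. Qed.

Lemma lscalEl (c : C) f g : lmul (c *: f) g = c *: lmul f g.
Proof.
rewrite (lmulw (msuppZ_le _ _) (fsubset_refl _)) scaler_sumr.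
apply: eq_bigr => k _; rewrite scaler_sumr; apply: eq_bigr => l _.
by rewrite mcoeffZ scalerA mulrA.
Qed.

Lemma lscalEr (c : C) f g : lmul f (c *: g) = c *: lmul f g.
Proof. by rewrite lmulC lscalEl lmulC. Qed.

Lemma lmulUU k l : lmul (zpow k) (zpow l) = zpow (k + l).
Proof.
rewrite (lmulw (d1 := [fset k]) (d2 := [fset l])) ?msuppU_le //.
by rewrite !big_seq_fset1 !mcoeffUU mulr1 scale1r.
Qed.

Lemma laurentE f : f = \sum_(k <- msupp f) f@_k *: zpow k.
Proof.
rewrite {1}[f]monalgE; apply: eq_bigr => k _; apply/malgP => l.
by rewrite mcoeffZ !mcoeffU mulrnAr mulr1.
Qed.

Lemma lmul_suml (I : Type) (r : seq I) (F : I -> laurent C) g :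
  lmul (\sum_(i <- r) F i) g = \sum_(i <- r) lmul (F i) g.
Proof. exact: (big_morph (lmul^~ g) (fun _ _ => lmulDl _ _ _) (lmul0l g)). Qed.

Lemma lmul_sumr (I : Type) (r : seq I) (F : I -> laurent C) g :
  lmul g (\sum_(i <- r) F i) = \sum_(i <- r) lmul g (F i).
Proof. exact: (big_morph (lmul g) (fun _ _ => lmulDr _ _ _) (lmulr0 g)). Qed.

Lemma lmulA : associative lmul.
Proof.
move=> f g h; rewrite [f]laurentE (lmul_suml _ _ (lmul g h)).
rewrite (lmul_suml _ _ g) (lmul_suml _ _ h); apply: eq_bigr => k _.
rewrite !lscalEl; congr (_ *: _).
rewrite [g]laurentE (lmul_suml _ _ h) 2!(lmul_sumr _ _ (zpow k)).
rewrite (lmul_suml _ _ h); apply: eq_bigr => l _.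
rewrite !(lscalEl, lscalEr); congr (_ *: _).
rewrite [h]laurentE (lmul_sumr _ _ (zpow l)) (lmul_sumr _ _ (zpow k)).
rewrite (lmul_sumr _ _ (lmul _ _)); apply: eq_bigr => m _.
by rewrite !lscalEr !lmulUU addrA.
Qed.

Lemma lmul1 : left_id (zpow 0) lmul.
Proof.
move=> f; rewrite [f]laurentE lmul_sumr; apply: eq_bigr => k _.
by rewrite lscalEr lmulUU add0r.
Qed.

Lemma zpow0_neq0 : zpow 0 != 0.
Proof. by rewrite monalgU_eq0 oner_eq0. Qed.

HB.instance Definition _ := GRing.Zmodule_isComNzRing.Build (laurent C)
  lmulA lmulC lmul1 lmulDl zpow0_neq0.

Fact lscalAl (c : C) f g : c *: (f * g) = (c *: f) * g.
Proof. by rewrite [RHS]lscalEl. Qed.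

HB.instance Definition _ := GRing.Lmodule_isLalgebra.Build C (laurent C) lscalAl.

Fact lscalAr (c : C) f g : c *: (f * g) = f * (c *: g).
Proof. by rewrite [RHS]lscalEr. Qed.

HB.instance Definition _ := GRing.Lalgebra_isAlgebra.Build C (laurent C) lscalAr.

Lemma zpow0 : zpow 0 = 1.
Proof. by []. Qed.

Lemma zpowD k l : zpow (k + l) = zpow k * zpow l.
Proof. by rewrite [RHS]lmulUU. Qed.

End LaurentRing.

Arguments zpow {C} k.

Section OPUC.
Variable C : numClosedFieldType.
Implicit Types (alpha : nat -> C) (p : {poly C}).

(* p^*(z) = z^n * conj (p (1 / conj z)), written on coefficients. *)
Definition rev_poly (n : nat) p : {poly C} := \poly_(i < n.+1) (p`_(n - i))^*.

Lemma horner_rev_poly (n : nat) p (z : C) : (size p <= n.+1)%N -> z != 0 ->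
  (rev_poly n p).[z] = z ^+ n * (p.[(z^*)^-1])^*.
Proof.
move=> sp z0; rewrite horner_poly (horner_coef_wide _ sp) rmorph_sum mulr_sumr.
rewrite (reindex_inj rev_ord_inj) /=; apply: eq_bigr => i _.
have le_in : (i <= n)%N by rewrite -ltnS.
rewrite subSS subKn // rmorphM rmorphXn fmorphV /= conjCK mulrCA.
by rewrite exprVn -expfB_cond // (negPf z0).
Qed.

Fixpoint Phi alpha (n : nat) : {poly C} :=
  if n is m.+1
  then 'X * Phi alpha m - (alpha m)^* *: rev_poly m (Phi alpha m)
  else 1.

Lemma size_Phi alpha n : (size (Phi alpha n) <= n.+1)%N.
Proof.
elim: n => [|n IH] /=; first by rewrite size_poly1.
rewrite (leq_trans (size_polyD _ _)) // size_polyN geq_max; apply/andP; split.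
  by rewrite (leq_trans (size_polyMleq _ _)) // size_polyX.
by rewrite (leq_trans (size_scale_leq _ _)) // (leq_trans (size_poly _ _)).
Qed.

(* t_j^(n) is (Phi alpha n)`_j. *)
Definition is_moment_functional alpha (mu : {scalar (laurent C)}) : Prop :=
  [/\ mu 1 = 1,
      forall n : nat, (0 < n)%N ->
        mu (zpow n) = - \sum_(j < n) (Phi alpha n)`_j * mu (zpow j)
    & forall n : nat, (0 < n)%N -> mu (zpow (- n%:Z)) = (mu (zpow n))^*].

(* On Laurent polynomials conj w is identified with w^-1, so that
   g (w + conj w) is g evaluated at w + w^-1 in the algebra laurent C. *)
Definition gamma_functional (mu : {scalar (laurent C)}) (g : {poly C}) : C :=
  mu (horner_alg (zpow 1 + zpow (- 1) : laurent C) g).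

Fact gamma_functional_is_linear (mu : {scalar (laurent C)}) :
  scalar (gamma_functional mu).
Proof.
move=> c p q.
by rewrite /gamma_functional !linearD linearZ /= mulr_algl linearZ.
Qed.

HB.instance Definition _ (mu : {scalar (laurent C)}) :=
  GRing.isLinear.Build C {poly C} C *%R (gamma_functional mu)
    (gamma_functional_is_linear mu).

Definition monic_OPS (gamma : {scalar {poly C}}) (P : nat -> {poly C}) : Prop :=
  forall n : nat,
    [/\ P n \is monic,
        size (P n) = n.+1,
        forall k : nat, (k < n)%N -> gamma ('X^k * P n) = 0
      & gamma ('X^n * P n) != 0].

Definition quasi_definite (gamma : {scalar {poly C}}) : Prop :=
  exists P : nat -> {poly C}, monic_OPS gamma P.

(* The functional characterized by is_moment_functional exists. *)
Fixpoint moments alpha (n : nat) : seq C :=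
  if n is m.+1 then
    rcons (moments alpha m)
      (if m is 0 then 1
       else - \sum_(j < m) (Phi alpha m)`_j * (moments alpha m)`_j)
  else [::].

Definition moment alpha (k : int) : C :=
  match k with
  | Posz n => (moments alpha n.+1)`_n
  | Negz n => ((moments alpha n.+2)`_n.+1)^*
  end.

Lemma size_moments alpha n : size (moments alpha n) = n.
Proof. by elim: n => //= n IH; rewrite size_rcons IH. Qed.

Lemma nth_moments alpha n j : (j < n)%N ->
  (moments alpha n)`_j = moment alpha j.
Proof.
elim: n => // n IH; rewrite ltnS leq_eqVlt => /predU1P[->|lt_jn] //.
by rewrite nth_rcons size_moments lt_jn IH.
Qed.

Lemma moment0 alpha : moment alpha 0 = 1.
Proof. by []. Qed.

Lemma momentS alpha n : (0 < n)%N ->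
  moment alpha n = - \sum_(j < n) (Phi alpha n)`_j * moment alpha j.
Proof.
case: n => // n _; rewrite /moment -/(moments alpha n.+1).
rewrite [in LHS]/= nth_rcons size_rcons size_moments ltnn eqxx.
congr (- _); apply: eq_bigr => j _.
by congr (_ * _); exact: (@nth_moments alpha n.+1).
Qed.

Definition mu_of alpha (f : laurent C) : C :=
  \sum_(k <- msupp f) f@_k * moment alpha k.

Lemma mu_ofw alpha (d : {fset int}) (f : laurent C) : msupp f `<=` d ->
  mu_of alpha f = \sum_(k <- d) f@_k * moment alpha k.
Proof.
move=> le_d; rewrite /mu_of; apply: big_fset_incl => // k _ /mcoeff_outdom ->.
by rewrite mul0r.
Qed.

Fact mu_of_is_linear alpha : scalar (mu_of alpha).
Proof.
move=> c f g; pose d := msupp f `|` msupp g.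
have le_f : msupp f `<=` d by rewrite fsubsetUl.
have le_g : msupp g `<=` d by rewrite fsubsetUr.
have le_fg : msupp (c *: f + g) `<=` d.
  by rewrite (fsubset_trans (msuppD_le _ _)) // fsetSU // msuppZ_le.
rewrite (mu_ofw alpha le_f) (mu_ofw alpha le_g) (mu_ofw alpha le_fg).
rewrite mulr_sumr -big_split; apply: eq_bigr => k _ /=.
by rewrite mcoeffD mcoeffZ mulrDl mulrA.
Qed.

HB.instance Definition _ alpha :=
  GRing.isLinear.Build C (laurent C) C *%R (mu_of alpha) (mu_of_is_linear alpha).

Lemma mu_of_zpow alpha k : mu_of alpha (zpow k) = moment alpha k.
Proof. by rewrite (mu_ofw alpha msuppU_le) big_seq_fset1 mcoeffUU mul1r. Qed.

Lemma mu_ofP alpha : is_moment_functional alpha (mu_of alpha).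
Proof.
split=> [|n n0|[//|n] _] /=; first exact: (mu_of_zpow alpha 0).
  rewrite mu_of_zpow momentS //; congr (- _); apply: eq_bigr => j _.
  by rewrite mu_of_zpow.
by rewrite -NegzE !mu_of_zpow.
Qed.

Lemma moment_functional_uniq alpha (mu nu : {scalar (laurent C)}) :
  is_moment_functional alpha mu -> is_moment_functional alpha nu -> mu =1 nu.
Proof.
move=> [mu1 muS muN] [nu1 nuS nuN].
have pos (n : nat) : mu (zpow n) = nu (zpow n).
  elim/ltn_ind: n => -[_|n IH]; first by rewrite zpow0 mu1 nu1.
  rewrite muS // nuS //; congr (- _); apply: eq_bigr => j _.
  by rewrite IH.
move=> f; rewrite [f]laurentE !linear_sum; apply: eq_bigr => -[n|n] _ /=.
  by rewrite !linearZ /= pos.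
by rewrite !linearZ /= NegzE muN // nuN // pos.
Qed.

End OPUC.

(* alpha_(m-1), with the convention alpha_(-1) := -1. *)
Definition alpha_pred (R : nzRingType) (alpha : nat -> R) (m : nat) : R :=
  if m is k.+1 then alpha k else - 1.

(* Main.v *)
From HB Require Import structures.
Require Import Defs.
From mathcomp Require Import all_boot all_order all_algebra.
From mathcomp Require Import zify ring.
From mathcomp Require Import reals complex.

Set Implicit Arguments.
Unset Strict Implicit.
Unset Printing Implicit Defensive.

Import Order.TTheory GRing.Theory Num.Theory.
Local Open Scope ring_scope.

(** Orthogonality on the unit circle passes to the interval by symmetrization
(Szego's and Geronimus' passage from w to x = w + 1/w).

On the circle, the recurrence for Phi makes Phi_n orthogonal to z^k for
k < n, and its squared norm mu(z^-n Phi_n), which may be negative, is the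
product of the factors 1 - |alpha_k|^2 for k < n ([Phi_orthogonal],
[Phi_normE]); it is nonzero because no alpha_k has modulus 1. Reversing a polynomial conjugates and reflects its
moments ([pairing_rev]), so Phi_n^* is orthogonal to z^k for 1 <= k <= n.

For real alpha, F = Phi_2n + Phi_2n^* is palindromic of degree 2n, so z^-n F is
invariant under z -> 1/z and hence a polynomial in z + 1/z of degree n; its
leading coefficient is F's, namely 1 - alpha_(2n-1), and dividing by it gives
the monic [Pgamma]. For k < n, expanding (z + 1/z)^k z^-n F produces only the
shifts z^-j F with 0 < j < 2n, all of which mu annihilates. For k = n > 0 the two
extreme shifts j = 0 and j = 2n appear as well, and each contributes the
squared norm of Phi_2n, which is why gamma(x^n P_n) does not vanish
([gamma_Pgamma_norm]).

A functional has at most one sequence of monic orthogonal polynomials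
([monic_OPS_uniq]), so the formula found for this sequence holds for every
one. *)

(** * Uniqueness of monic orthogonal polynomials *)

(** Only the top coefficient of q survives, as P n kills all lower powers. *)
Lemma monic_OPS_mul (C : numClosedFieldType) (h : {scalar {poly C}})
    P n (q : {poly C}) :
  monic_OPS h P -> (size q <= n.+1)%N ->
  h (q * P n) = q`_n * h ('X^n * P n).
Proof.
move=> /(_ n) [_ _ orth _] sq.
rewrite -[q in LHS](take_poly_id sq) [take_poly _ _]poly_def.
rewrite mulr_suml linear_sum big_ord_recr big1 => [|i _] /=.
  by rewrite add0r -scalerAl linearZ.
by rewrite -scalerAl linearZ /= orth ?mulr0.
Qed.

(** The difference d of two candidates for P n has some degree m < n and is
orthogonal to every polynomial of degree < n, in particular to P m; but pairing
it with P m isolates its leading coefficient, which must then vanish. *)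
Lemma monic_OPS_uniq (C : numClosedFieldType) (h : {scalar {poly C}}) P Q :
  monic_OPS h P -> monic_OPS h Q -> P =1 Q.
Proof.
move=> hP hQ n; apply/eqP; rewrite -subr_eq0; apply/negPn/negP => nz.
have [mP sP oP _] := hP n; have [mQ sQ oQ _] := hQ n.
set d := P n - Q n in nz.
have sd : (size d <= n)%N.
  (* Both are monic of degree n, so the top coefficients cancel. *)
  apply/leq_sizeP => j; rewrite leq_eqVlt => /predU1P[<-|lt_nj].
    move: (monicP mP) (monicP mQ); rewrite /lead_coef sP sQ coefB /= => -> ->.
    by rewrite subrr.
  by rewrite coefB !nth_default ?subrr ?sP ?sQ.
pose m := (size d).-1.
have dm : size d = m.+1 by rewrite /m prednK // lt0n size_poly_eq0.
have [mm sm _ nzm] := hP m.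
have hX (q : {poly C}) : (size q <= n)%N -> h (q * d) = 0.
  move=> sq; rewrite mulrBr linearB /= (monic_OPS_mul hP) 1?(leq_trans sq) //.
  rewrite (monic_OPS_mul hQ) 1?(leq_trans sq) // nth_default //.
  by rewrite !mul0r subrr.
have := hX (P m); rewrite sm -dm => /(_ sd)/eqP.
rewrite mulrC (monic_OPS_mul hP) ?dm // mulf_eq0 (negPf nzm) orbF.
by rewrite -/(m.+1.-1) -dm -lead_coefE lead_coef_eq0 (negPf nz).
Qed.

(** * Palindromic polynomials in the variable z + 1/z *)

Section Palindromic.
Variable A : comNzRingType.

(** Chebyshev polynomials in the normalization T_n(z + 1/z) = z^n + z^-n: they
are monic for n > 0, while T_0 = 2. *)
Fixpoint Tpoly (n : nat) : {poly A} :=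
  match n with
  | 0 => 2%:R
  | 1 => 'X
  | (m.+1 as k).+1 => 'X * Tpoly k - Tpoly m
  end.

Arguments Tpoly : simpl nomatch.

Lemma TpolySS n : Tpoly n.+2 = 'X * Tpoly n.+1 - Tpoly n.
Proof. by []. Qed.

Lemma Tpoly_size_lead n : (size (Tpoly n) <= n.+1)%N /\ (Tpoly n.+1)`_n.+1 = 1.
Proof.
suff: [/\ (size (Tpoly n) <= n.+1)%N, (size (Tpoly n.+1) <= n.+2)%N
   & (Tpoly n.+1)`_n.+1 = 1] by case.
elim: n => [|n [IH1 IH2 IH3]].
  by rewrite /= size_polyX coefX -polyC_natr size_polyC; split=> //; case: (_ != _).
have sz : (size (Tpoly n.+2) <= n.+3)%N.
  rewrite TpolySS (leq_trans (size_polyD _ _)) // size_polyN geq_max.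
  rewrite (leq_trans (size_polyMleq _ _)) ?size_polyX ?add2n //=.
  by rewrite (leq_trans IH1) //; lia.
split=> //; rewrite TpolySS coefB coefXM /= IH3 nth_default ?subr0 //.
by rewrite (leq_trans IH1).
Qed.

Lemma horner_alg_Tpoly (B : comAlgType A) (u v : B) n : u * v = 1 ->
  horner_alg (u + v) (Tpoly n) = u ^+ n + v ^+ n.
Proof.
move=> uv1; suff: horner_alg (u + v) (Tpoly n) = u ^+ n + v ^+ n /\
  horner_alg (u + v) (Tpoly n.+1) = u ^+ n.+1 + v ^+ n.+1 by case.
elim: n => [|n [IH1 IH2]].
  by rewrite /= rmorph_nat horner_algX !expr0 !expr1.
split=> //; rewrite TpolySS.
move: (Tpoly n) (Tpoly n.+1) IH1 IH2 => s t IHs IHt.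
rewrite rmorphB rmorphM /= horner_algX IHs IHt.
rewrite mulrDl !mulrDr -!exprS (exprS v n) (exprS u n) !mulrA uv1 (mulrC v u) uv1 !mul1r.
ring.
Qed.

(** Pairing the coefficients of z^(n+k) and z^(n-k) in a palindromic F of degree
2n gives z^-n F(z) = F_n + sum_(k > 0) F_(n+k) (z^k + z^-k). The term k = 0 is
kept apart because T_0 = 2 would count it twice. *)
Definition palindromic_half n (F : {poly A}) : {poly A} :=
  (F`_n)%:P + \sum_(k < n) F`_(n + k.+1) *: Tpoly k.+1.

Lemma size_palindromic_half n (F : {poly A}) :
  (size (palindromic_half n F) <= n.+1)%N.
Proof.
rewrite (leq_trans (size_polyD _ _)) // geq_max (leq_trans (size_polyC_leq1 _)) //=.
rewrite (leq_trans (size_sum _ _ _)) //; apply/bigmax_leqP => k _.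
rewrite (leq_trans (size_scale_leq _ _)) //.
by have [sT _] := Tpoly_size_lead k.+1; rewrite (leq_trans sT) // !ltnS.
Qed.

Lemma lead_palindromic_half n (F : {poly A}) :
  (palindromic_half n F)`_n = F`_(2 * n).
Proof.
case: n => [|n]; rewrite /palindromic_half ?big_ord0 ?addr0 ?coefC //.
rewrite coefD coefC add0r coef_sum big_ord_recr big1 /= => [|k _].
  by have [_ T1] := Tpoly_size_lead n; rewrite add0r coefZ T1 mulr1 mul2n addnn.
have [sT _] := Tpoly_size_lead k.+1.
by rewrite coefZ [X in _ * X]nth_default ?mulr0 // (leq_trans sT) ?ltnS.
Qed.

Lemma horner_alg_coef (B : algType A) (u : B) (p : {poly A}) m : (size p <= m)%N ->
  horner_alg u p = \sum_(i < m) p`_i *: u ^+ i.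
Proof.
move=> sp; rewrite -[p in LHS](take_poly_id sp) [take_poly _ _]poly_def rmorph_sum.
apply: eq_bigr => i _.
by rewrite -mul_polyC rmorphM rmorphXn /= horner_algC horner_algX mulr_algl.
Qed.

(** The inverse pair u, v is taken in an arbitrary commutative algebra because
the identity serves twice: for w and 1/w among Laurent polynomials, where gamma
is defined, and for a nonzero number z and 1/z. *)
Lemma horner_palindromic_half (B : comAlgType A) (u v : B) n (F : {poly A}) :
  u * v = 1 -> (size F <= (2 * n).+1)%N ->
  (forall i, (i <= 2 * n)%N -> F`_(2 * n - i) = F`_i) ->
  horner_alg (u + v) (palindromic_half n F) = v ^+ n * horner_alg u F.
Proof.
move=> uv1 sF palF; have uvX m : u ^+ m * v ^+ m = 1 by rewrite -exprMn uv1 expr1n.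
rewrite mul2n -addnn -addnS in sF.
rewrite (horner_alg_coef _ sF) big_split_ord big_ord_recl /= addn0.
rewrite rmorphD rmorph_sum /= horner_algC !mulrDr -scalerAr [v ^+ n * u ^+ n]mulrC uvX.
rewrite addrCA; congr (_ + _).
rewrite !mulr_sumr [X in _ = X + _](reindex_inj rev_ord_inj) -big_split.
apply: eq_bigr => k _ /=.
rewrite linearZ /= mulr_algl horner_alg_Tpoly // scalerDr [LHS]addrC.
rewrite -!scalerAr; congr (_ + _).
  rewrite -(palF (n - k.+1)%N); last by lia.
  have -> : (2 * n - (n - k.+1) = n + k.+1)%N by have := ltn_ord k; lia.
  congr (_ *: _).
  have {2}-> : n = (k.+1 + (n - k.+1))%N by have := ltn_ord k; lia.
  by rewrite [in RHS]exprD -mulrA (mulrC (v ^+ (n - k.+1))) uvX mulr1.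
by rewrite /bump add1n exprD mulrA (mulrC (v ^+ n)) uvX mul1r.
Qed.
End Palindromic.

(** This is what specializes [horner_palindromic_half] to numbers z and 1/z. *)
Lemma horner_alg_regular (A : comNzRingType) (z : A) (p : {poly A}) :
  horner_alg (z : A^o) p = p.[z].
Proof.
by rewrite /= horner_coef (@horner_alg_coef A A^o z p _ (leqnn _)).
Qed.

(** * Orthogonality on the unit circle *)

Section Szego.
Variables (C : numClosedFieldType) (alpha : nat -> C) (mu : {scalar (laurent C)}).

Local Notation L p := (horner_alg (zpow 1 : laurent C) p).

Lemma zpowX (k : int) (n : nat) : (zpow k : laurent C) ^+ n = zpow (k * n%:Z).
Proof.
elim: n => [|n IH]; first by rewrite mulr0.
by rewrite exprS IH -zpowD; congr zpow; rewrite -add1n PoszD mulrDr mulr1.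
Qed.

Definition pairing (k : int) (p : {poly C}) : C := mu (zpow k * L p).

Lemma pairing_coef (p : {poly C}) m k : (size p <= m)%N ->
  pairing k p = \sum_(i < m) p`_i * mu (zpow (k + i%:Z)).
Proof.
move=> sp; rewrite /pairing (horner_alg_coef _ sp) mulr_sumr linear_sum.
by apply: eq_bigr => i _; rewrite -scalerAr linearZ zpowX mul1r -zpowD.
Qed.

Lemma pairing_is_linear k : scalar (pairing k).
Proof.
by move=> c p q; rewrite /pairing linearD linearZ /= mulr_algl mulrDr -scalerAr linearP.
Qed.

HB.instance Definition _ k :=
  GRing.isLinear.Build C {poly C} C *%R (pairing k) (pairing_is_linear k).

Lemma pairingXM k p : pairing k ('X * p) = pairing (k + 1) p.
Proof. by rewrite /pairing rmorphM /= horner_algX mulrA zpowD. Qed.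

Hypothesis hmu : is_moment_functional alpha mu.

Lemma mu_conj k : mu (zpow (- k)) = (mu (zpow k))^*.
Proof.
have [mu1 _ muN] := hmu; case: k => [[|n]|n].
- by rewrite oppr0 zpow0 mu1 rmorph1.
- exact: muN.
by rewrite NegzE opprK muN // conjCK.
Qed.

(** On the circle p^*(w) = w^n conj(p(w)), and mu turns conjugation of the
argument into conjugation of the value. *)
Lemma pairing_rev (p : {poly C}) n k : (size p <= n.+1)%N ->
  pairing k (rev_poly n p) = (pairing (- k - n%:Z) p)^*.
Proof.
move=> sp; have sr : (size (rev_poly n p) <= n.+1)%N by exact: size_poly.
rewrite (pairing_coef _ sr) (pairing_coef _ sp).
rewrite rmorph_sum (reindex_inj rev_ord_inj); apply: eq_bigr => i _ /=.
have le_in : (i <= n)%N by rewrite -ltnS.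
rewrite rmorphM /= -mu_conj coef_poly subSS ltnS leq_subr subKn //.
by congr (_ * mu (zpow _)); lia.
Qed.

Lemma Phi_lead n : (Phi alpha n)`_n = 1.
Proof.
elim: n => [|n IH] /=; first by rewrite coef1.
by rewrite coefB coefXM coefZ coef_poly /= IH ltnn mulr0 subr0.
Qed.

(** As Phi n is monic, the recursion that defines mu(z^n) is this equation. *)
Lemma pairing_Phi n : (0 < n)%N -> pairing 0 (Phi alpha n) = 0.
Proof.
move=> n0; have [_ muS _] := hmu.
rewrite (pairing_coef _ (size_Phi alpha n)) big_ord_recr /= Phi_lead mul1r add0r muS //.
by under eq_bigr do rewrite add0r; rewrite subrr.
Qed.

Lemma pairing_PhiS n k : pairing k (Phi alpha n.+1) =
  pairing (k + 1) (Phi alpha n) -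
    (alpha n)^* * (pairing (- k - n%:Z) (Phi alpha n))^*.
Proof.
by rewrite /= linearB linearZ /= pairingXM pairing_rev ?size_Phi.
Qed.

(** The functional is only required to annihilate the Phi_n themselves, which is
orthogonality to z^0. The recurrence propagates it: against z^(k+1), Phi_(n+1)
reduces to Phi_n against z^k, and to Phi_n^* against z^(k+1), that is, Phi_n
against z^(n-k-1). *)
Lemma Phi_orthogonal n k : (k < n)%N -> pairing (- k%:Z) (Phi alpha n) = 0.
Proof.
elim: n k => // n IH [|k] lt_kn; first by rewrite oppr0 pairing_Phi.
rewrite pairing_PhiS.
have -> : - k.+1%:Z + 1 = - k%:Z by lia.
rewrite IH //.
have -> : - - k.+1%:Z - n%:Z = - (n - k.+1)%:Z by lia.
by rewrite IH ?rmorph0 ?mulr0 ?subrr //; lia.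
Qed.

Definition Phi_norm n : C := \prod_(k < n) (1 - `|alpha k| ^+ 2).

(** In the recurrence the only unknown term is mu(z Phi_n); it is determined by
0 = mu(Phi_(n+1)) = mu(z Phi_n) - conj(alpha_n) conj(mu(z^-n Phi_n)). *)
Lemma Phi_normE n : pairing (- n%:Z) (Phi alpha n) = Phi_norm n.
Proof.
elim: n => [|n IH].
  by rewrite oppr0 /pairing /= rmorph1 mulr1 /Phi_norm big_ord0; case: hmu.
rewrite pairing_PhiS /Phi_norm big_ord_recr -/(Phi_norm n) /=.
have -> : - n.+1%:Z + 1 = - n%:Z by lia.
have -> : - - n.+1%:Z - n%:Z = 1 by lia.
have := pairing_PhiS n 0; rewrite pairing_Phi // => /esym/eqP.
rewrite subr_eq0 add0r oppr0 sub0r IH => /eqP ->.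
rewrite rmorphM /= !conjCK mulrBr mulr1 normCK mulrA; congr (_ - _).
by rewrite mulrC [(alpha n)^* * _]mulrC.
Qed.

Lemma Phi_norm_real n : (Phi_norm n)^* = Phi_norm n.
Proof.
rewrite rmorph_prod; apply: eq_bigr => k _.
by rewrite rmorphB rmorph1 rmorphXn /= conj_normC.
Qed.

Lemma Phi_norm_neq0 n : (forall k, `|alpha k| != 1) -> Phi_norm n != 0.
Proof.
move=> ha; apply/prodf_neq0 => k _; rewrite subr_eq0 eq_sym.
by rewrite sqrp_eq1 ?ha.
Qed.
End Szego.

(** * Passage from the circle to the variable w + 1/w *)

Section Symmetrization.
Variables (C : numClosedFieldType) (alpha : nat -> C).
Hypothesis alpha_real : forall n, (alpha n)^* = alpha n.
Hypothesis alpha_norm : forall n, `|alpha n| != 1.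

Lemma Phi_real n i : ((Phi alpha n)`_i)^* = (Phi alpha n)`_i.
Proof.
elim: n i => [|n IH] i /=; first by rewrite coef1 rmorph_nat.
rewrite coefB coefXM coefZ coef_poly rmorphB rmorphM /= !alpha_real.
by rewrite !(fun_if Num.conj) rmorph0 !IH.
Qed.

Definition Phi_sym m : {poly C} := Phi alpha m + rev_poly m (Phi alpha m).

Lemma size_Phi_sym m : (size (Phi_sym m) <= m.+1)%N.
Proof.
by rewrite (leq_trans (size_polyD _ _)) // geq_max size_Phi size_poly.
Qed.

Lemma coef_Phi_sym m i : (i <= m)%N ->
  (Phi_sym m)`_i = (Phi alpha m)`_i + (Phi alpha m)`_(m - i).
Proof. by move=> le_im; rewrite coefD coef_poly ltnS le_im Phi_real. Qed.

Lemma Phi_sym_palindromic m i : (i <= m)%N ->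
  (Phi_sym m)`_(m - i) = (Phi_sym m)`_i.
Proof.
by move=> le_im; rewrite !coef_Phi_sym ?leq_subr // subKn // addrC.
Qed.

(** For m > 0 the constant term of Phi_m is - conj(alpha_(m-1)). At m = 0 the
two summands of Phi_sym are both 1, which is what alpha_(-1) = -1 accounts
for. *)
Lemma Phi_sym_lead m : (Phi_sym m)`_m = 1 - alpha_pred alpha m.
Proof.
rewrite coef_Phi_sym // subnn Phi_lead; case: m => [|m] /=.
  by rewrite coef1 opprK.
by rewrite coefB coefXM coefZ coef_poly subn0 Phi_lead rmorph1 mulr1 sub0r alpha_real.
Qed.

Lemma alpha_pred_neq1 m : 1 - alpha_pred alpha m != 0.
Proof.
case: m => [|m] /=; first by rewrite opprK (pnatr_eq0 C 2).
rewrite subr_eq0; apply: contraNneq (alpha_norm m) => <-.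
by rewrite normr1.
Qed.

Definition Pgamma n : {poly C} :=
  (1 - alpha_pred alpha (2 * n))^-1 *: palindromic_half n (Phi_sym (2 * n)).

Lemma horner_Pgamma n z : z != 0 ->
  (Pgamma n).[z + z^-1] =
    (1 - alpha_pred alpha (2 * n))^-1 * z ^- n * (Phi_sym (2 * n)).[z].
Proof.
move=> z0; rewrite hornerZ -mulrA; congr (_ * _).
have := @horner_palindromic_half C C^o z z^-1 n _ (divff z0)
  (size_Phi_sym (2 * n)) (@Phi_sym_palindromic _).
by rewrite !horner_alg_regular exprVn.
Qed.

Lemma Pgamma_monic n : Pgamma n \is monic /\ size (Pgamma n) = n.+1.
Proof.
have Pn1 : (Pgamma n)`_n = 1.
  by rewrite coefZ lead_palindromic_half Phi_sym_lead mulVf ?alpha_pred_neq1.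
have sP : size (Pgamma n) = n.+1.
  apply/eqP; rewrite eqn_leq (leq_trans (size_scale_leq _ _)) ?size_palindromic_half //=.
  by rewrite ltnNge; apply/negP => /leq_sizeP/(_ n (leqnn n))/eqP; rewrite Pn1 oner_eq0.
by split=> //; rewrite monicE lead_coefE sP Pn1.
Qed.

Variable mu : {scalar (laurent C)}.
Hypothesis hmu : is_moment_functional alpha mu.

(** Binomial expansion of (w + 1/w)^k against w^-n Phi_sym. *)
Lemma gamma_Pgamma k n :
  gamma_functional mu ('X^k * Pgamma n) =
  (1 - alpha_pred alpha (2 * n))^-1 *
  \sum_(i < k.+1) pairing mu (k%:Z - (2 * i)%:Z - n%:Z) (Phi_sym (2 * n)) *+ 'C(k, i).
Proof.
rewrite -scalerAr linearZ /=; congr (_ * _).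
rewrite /gamma_functional rmorphM rmorphXn /= horner_algX.
have uv1 : (zpow 1 * zpow (- 1) : laurent C) = 1 by rewrite -zpowD.
rewrite (horner_palindromic_half uv1 (size_Phi_sym _) (@Phi_sym_palindromic _)).
rewrite exprDn mulr_suml linear_sum; apply: eq_bigr => i _ /=.
rewrite mulrnAl linearMn /=; congr (_ *+ _).
rewrite /pairing !zpowX mulrA -!zpowD; congr (mu (zpow _ * _)).
by have := ltn_ord i; lia.
Qed.

Lemma pairing_Phi_sym k m : pairing mu k (Phi_sym m) =
  pairing mu k (Phi alpha m) + (pairing mu (- k - m%:Z) (Phi alpha m))^*.
Proof. by rewrite linearD /= (pairing_rev hmu) ?size_Phi. Qed.

Lemma Phi_sym_orthogonal j m : (0 < j < m)%N ->
  pairing mu (- j%:Z) (Phi_sym m) = 0.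
Proof.
move=> /andP[j0 jm]; rewrite pairing_Phi_sym (Phi_orthogonal hmu jm) add0r.
have -> : - - j%:Z - m%:Z = - (m - j)%:Z by lia.
by rewrite (Phi_orthogonal hmu) ?rmorph0 //; lia.
Qed.

Lemma Phi_sym_ends m : (0 < m)%N ->
  pairing mu 0 (Phi_sym m) = Phi_norm alpha m /\
  pairing mu (- m%:Z) (Phi_sym m) = Phi_norm alpha m.
Proof.
move=> m0; rewrite !pairing_Phi_sym oppr0 sub0r opprK subrr.
by rewrite (Phi_normE hmu) (pairing_Phi hmu m0) rmorph0 addr0 add0r Phi_norm_real.
Qed.

Lemma Pgamma_orthogonal k n : (k < n)%N ->
  gamma_functional mu ('X^k * Pgamma n) = 0.
Proof.
move=> lt_kn; rewrite gamma_Pgamma big1 ?mulr0 // => i _; have lt_ik := ltn_ord i.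
have -> : k%:Z - (2 * i)%:Z - n%:Z = - (n + 2 * i - k)%:Z by lia.
by rewrite Phi_sym_orthogonal ?mul0rn //; lia.
Qed.

(** In the expansion of (w + 1/w)^n only the extreme terms w^n and w^-n reach
the ends of Phi_sym, each with binomial coefficient 1. For n = 0 the two ends
coincide and the factor 2 comes from Phi_sym 0 = 2. *)
Lemma gamma_Pgamma_norm n : gamma_functional mu ('X^n * Pgamma n) =
  (1 - alpha_pred alpha (2 * n))^-1 * (Phi_norm alpha (2 * n) *+ 2).
Proof.
rewrite gamma_Pgamma; congr (_ * _); case: n => [|n].
  rewrite big_ord1 pairing_Phi_sym (Phi_normE hmu 0).
  by rewrite Phi_norm_real.
have [E0 E1] := @Phi_sym_ends (2 * n.+1) isT.
rewrite big_ord_recl big_ord_recr big1 /= => [|i _].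
  rewrite !bin0 /bump add1n binn !mulr1n.
  have -> : n.+1%:Z - (2 * 0)%:Z - n.+1%:Z = 0 by lia.
  have -> : n.+1%:Z - (2 * n.+1)%:Z - n.+1%:Z = - (2 * n.+1)%:Z by lia.
  by rewrite E0 E1 add0r.
have lt_in := ltn_ord i; rewrite /bump add1n.
have -> : n.+1%:Z - (2 * i.+1)%:Z - n.+1%:Z = - (2 * i.+1)%:Z by lia.
by rewrite Phi_sym_orthogonal ?mul0rn //; lia.
Qed.

Lemma Pgamma_monic_OPS : monic_OPS (gamma_functional mu) Pgamma.
Proof.
move=> n; have [mP sP] := Pgamma_monic n; split=> // [k|].
  exact: Pgamma_orthogonal.
rewrite /= gamma_Pgamma_norm mulf_neq0 ?invr_neq0 ?alpha_pred_neq1 //.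
by rewrite mulrn_eq0 /= Phi_norm_neq0.
Qed.
End Symmetrization.

Local Open Scope complex_scope.

Theorem theorem3p2 (R : realType) (alpha : nat -> R) (N : nat)
    (halpha_lt : forall n : nat, (n < N)%N -> `|alpha n| != 1)
    (halpha_ge : forall n : nat, (N <= n)%N -> `|alpha n| < 1)
    (mu : {scalar (laurent R[i])})
    (hmu : is_moment_functional (fun n => (alpha n)%:C) mu) :
  quasi_definite (gamma_functional mu) /\
  forall P : nat -> {poly R[i]}, monic_OPS (gamma_functional mu) P ->
    forall (n : nat) (z : R[i]), z != 0 ->
      (P n).[z + z^-1] =
        (1 - (alpha_pred alpha (2 * n))%:C)^-1 * z ^- n *
        ((Phi (fun k => (alpha k)%:C) (2 * n)).[z] +
         (rev_poly (2 * n) (Phi (fun k => (alpha k)%:C) (2 * n))).[z]).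
Proof.
set a := fun k => (alpha k)%:C in hmu *.
have a_real n : Num.conj (a n) = a n by apply/CrealP; rewrite complex_real.
have a_norm n : `|a n| != 1.
  rewrite normc_def /= expr0n addr0 sqrtr_sqr eq_complex /= eqxx andbT.
  have [/halpha_lt//|/halpha_ge] := ltnP n N.
  by rewrite lt_neqAle => /andP[].
have OPS := Pgamma_monic_OPS a_real a_norm hmu.
split; first by exists (Pgamma a).
move=> P hP n z z0; rewrite (monic_OPS_uniq hP OPS) (horner_Pgamma a_real n z0) hornerD.
by congr ((1 - _)^-1 * _ * _); case: (2 * n)%N => //=; rewrite rmorphN1.
Qed.
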